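(* Let $m$ and $n$ be non-zero integers. The Baumslag–Solitar group $BS(m,n)=\langle a,b\mid ab^ma^{-1}=b^n\rangle$ is ICC if and only if $|m|\neq|n|$.
   Context: A group $G$ is ICC (has infinite conjugacy classes) if it is infinite and for every $x\in G\setminus\{1\}$ the set $\{gxg^{-1}:g\in G\}$ is infinite. *)

(* Defs.v *)
From HB Require Import structures.
From mathcomp Require Import all_boot all_order all_algebra.
From mathcomp Require Import boolp classical_sets cardinality.

Set Implicit Arguments.
Unset Strict Implicit.
Unset Printing Implicit Defensive.

Local Open Scope classical_set_scope.
Local Open Scope quotient_scope.

(* The letter (x, false) stands for the generator x, and (x, true) for its    *)
(* inverse. Words are not assumed to be reduced.                              *)
Definition word (X : choiceType) := seq (X * bool).

HB.instance Definition _ (X : choiceType) := Choice.on (word X).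

Definition inv_letter (X : choiceType) (l : X * bool) : X * bool :=
  (l.1, ~~ l.2).

Definition inv_word (X : choiceType) (w : word X) : word X :=
  rev (map (@inv_letter X) w).

Definition gen (X : choiceType) (x : X) : word X := [:: (x, false)].

Definition gen_exp (X : choiceType) (x : X) (k : int) : word X :=
  match k with
  | Posz p => nseq p (x, false)
  | Negz p => nseq p.+1 (x, true)
  end.

(* The congruence on words generated by free cancellation and by the set R of *)
(* relations, a pair (u, v) in R encoding the relation u = v.                 *)
Inductive word_eq (X : choiceType) (R : set (word X * word X)) :
    word X -> word X -> Prop :=
| word_eq_rel u v : R (u, v) -> word_eq R u v
| word_eq_cancel l : word_eq R [:: l; inv_letter l] [::]
| word_eq_cat u1 v1 u2 v2 :
    word_eq R u1 v1 -> word_eq R u2 v2 -> word_eq R (u1 ++ u2) (v1 ++ v2)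
| word_eq_refl u : word_eq R u u
| word_eq_sym u v : word_eq R u v -> word_eq R v u
| word_eq_trans u v w : word_eq R u v -> word_eq R v w -> word_eq R u w.

Section Presented.
Variables (X : choiceType) (R : set (word X * word X)).

Definition word_eqb (u v : word X) : bool := `[< word_eq R u v >].

Lemma word_eqb_refl : reflexive word_eqb.
Proof. by move=> u; apply/asboolP/word_eq_refl. Qed.

Lemma word_eqb_sym : symmetric word_eqb.
Proof.
by move=> u v; apply/asboolP/asboolP; apply: word_eq_sym.
Qed.

Lemma word_eqb_trans : transitive word_eqb.
Proof.
move=> v u w /asboolP uv /asboolP vw.
by apply/asboolP/(word_eq_trans uv vw).
Qed.

Canonical word_eqb_equiv :=
  EquivRel word_eqb word_eqb_refl word_eqb_sym word_eqb_trans.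

Definition presented := {eq_quot word_eqb}.

HB.instance Definition _ := Choice.on presented.
HB.instance Definition _ := Quotient.on presented.

Definition pres_class (w : word X) : presented := \pi_presented w.

Definition pres_one : presented := pres_class [::].

Definition pres_inv (g : presented) : presented :=
  pres_class (inv_word (repr g)).

Definition pres_mul (g h : presented) : presented :=
  pres_class (repr g ++ repr h).

Lemma pres_classP u v : pres_class u = pres_class v <-> word_eq R u v.
Proof.
by split=> [/eqmodP/asboolP|/asboolP H]; [|apply/eqmodP].
Qed.

Lemma pres_class_repr (g : presented) : pres_class (repr g) = g.
Proof. exact: reprK. Qed.

Lemma word_eq_repr u : word_eq R (repr (pres_class u)) u.
Proof. by apply/pres_classP; rewrite pres_class_repr. Qed.

Lemma pres_class_cat u v :
  pres_class (u ++ v) = pres_mul (pres_class u) (pres_class v).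
Proof.
by apply/pres_classP/word_eq_sym/word_eq_cat; apply: word_eq_repr.
Qed.

Lemma inv_letterK : involutive (@inv_letter X).
Proof. by case=> x e; rewrite /inv_letter /= negbK. Qed.

Lemma inv_wordK : involutive (@inv_word X).
Proof.
move=> u; rewrite /inv_word map_rev revK -map_comp.
by rewrite (eq_map (g := id)) ?map_id // => l /=; apply: inv_letterK.
Qed.

Lemma word_eq_mulV u : word_eq R (u ++ inv_word u) [::].
Proof.
elim: u => [|l u IHu]; first exact: word_eq_refl.
rewrite /inv_word /= rev_cons -rcons_cat -cats1.
apply: (word_eq_trans _ (word_eq_cancel R l)).
apply: (word_eq_cat (u1 := [:: l]) (v1 := [:: l])); first exact: word_eq_refl.
by apply: (word_eq_cat (v1 := [::])) => //; apply: word_eq_refl.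
Qed.

Lemma pres_mulA : associative pres_mul.
Proof.
move=> g h k; rewrite -(pres_class_repr g) -(pres_class_repr h).
by rewrite -(pres_class_repr k) -!pres_class_cat catA.
Qed.

Lemma pres_mul1 : left_id pres_one pres_mul.
Proof. by move=> g; rewrite -(pres_class_repr g) -pres_class_cat. Qed.

Lemma pres_mulr1 : right_id pres_one pres_mul.
Proof. by move=> g; rewrite -(pres_class_repr g) -pres_class_cat cats0. Qed.

Lemma pres_mulV : left_inverse pres_one pres_inv pres_mul.
Proof.
move=> g; rewrite -{2}(pres_class_repr g) -pres_class_cat; apply/pres_classP.
by have := word_eq_mulV (inv_word (repr g)); rewrite inv_wordK.
Qed.

Lemma pres_mulrV : right_inverse pres_one pres_inv pres_mul.
Proof.
move=> g; rewrite -{1}(pres_class_repr g) -pres_class_cat.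
by apply/pres_classP/word_eq_mulV.
Qed.

HB.instance Definition _ := isGroup.Build presented
  pres_mulA pres_mul1 pres_mulr1 pres_mulV pres_mulrV.

End Presented.

(* bool serves as the two-element generating set {a, b}.                      *)

Definition bs_a : bool := true.
Definition bs_b : bool := false.

Definition bs_relation (m n : int) : word bool * word bool :=
  (gen bs_a ++ gen_exp bs_b m ++ inv_word (gen bs_a), gen_exp bs_b n).

Definition BS (m n : int) : groupType := presented [set bs_relation m n].

Definition conj_class (G : groupType) (x : G) : set G :=
  [set (g * x * g^-1)%g | g in [set: G]].

Definition ICC (G : groupType) : Prop :=
  infinite_set [set: G] /\
  forall x : G, x <> 1%g -> infinite_set (conj_class x).

(* Main.v *)
Require Import Defs.
From mathcomp Require Import all_boot all_order all_algebra.
From mathcomp Require Import boolp classical_sets functions cardinality.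
From mathcomp Require Import zify.
Import GRing.Theory Num.Theory Order.TTheory.

(** Everything rests on Britton's normal form for the HNN extension BS(m, n).
Since a b^m = b^n a, a power of b standing before a can be reduced modulo n and
a power of b standing before a^-1 modulo m, so every element can be written
  b^c1 a^e1 b^c2 a^e2 ... b^cr a^er b^k
with each c_i a canonical residue and no factor a^e b^0 a^-e.  Letting the
letters act on these expressions by left multiplication defines an action of
the group (van der Waerden's trick, [act_word_eq]), whence the expression is
unique ([eltK], [nfK]); in particular r is an invariant of the element and b
has infinite order ([bpow_inj]).

Suppose |m| <> |n|, and let x <> 1.
If r > 0, choose the sign e for which a pinch a^e b^i a^-e requires the larger
of |m| and |n| to divide i.  This modulus is at least 2, and if it is 2 then
the other one is 1; there is then a t such that in a^e (b^t x b^-t) a^-e no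
cancellation occurs at either end ([exists_shift]).  Hence
a^(e j) b^t x b^-t a^(-e j) has exactly r + 2j letters a^+-1 and the conjugates
so obtained are pairwise distinct ([infinite_conj_syl]).
If r = 0, then x = b^k with k <> 0, and the conjugates a^j b^k a^-j are pairwise
distinct: otherwise some a^d with d > 0 commutes with b^k, hence with
b^(k m^d), whereas conjugation by a^d sends b^(k m^d) to b^(k n^d)
([infinite_conj_bpow]).

If |m| = |n|, conjugation by either generator preserves {b^m, b^-m}, so the
nontrivial element b^m has a finite conjugacy class ([norm_neq_of_ICC]). *)

Local Open Scope ring_scope.

(** * Normal forms *)

(** [Syl c e s] stands for b^c a s if [e] is false and for b^c a^-1 s if [e] is
true, and [Tail k] for b^k; the sign convention is that of letters in words.
Below, a^e is the letter a with sign [e], and -e is the opposite sign. *)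
Inductive normal_form := Tail of int | Syl of int & bool & normal_form.

(** [pinch e s]: multiplying [s] on the left by a^+-1, with sign [e], cancels
against the first syllable of [s]. *)
Definition pinch (e : bool) (s : normal_form) : bool :=
  if s is Syl c d _ then (c == 0) && (d == ~~ e) else false.

Definition drop_syl (s : normal_form) : normal_form :=
  if s is Syl _ _ s' then s' else s.

Definition push (e : bool) (s : normal_form) : normal_form :=
  if pinch e s then drop_syl s else Syl 0 e s.

Fixpoint syllables (s : normal_form) : nat :=
  if s is Syl _ _ s' then (syllables s').+1 else 0%N.

Fixpoint tail_exp (s : normal_form) : int :=
  match s with Tail k => k | Syl _ _ s' => tail_exp s' end.

(** The default [e] is the value for an expression without syllables; it is
meant to be the sign of the syllable that precedes [s]. *)
Fixpoint last_sign (e : bool) (s : normal_form) : bool :=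
  if s is Syl _ d s' then last_sign d s' else e.

Lemma infinite_of_injective (T : Type) (A : set T) (f : nat -> T) :
  injective f -> (forall j, A (f j)) -> infinite_set A.
Proof.
move=> finj fA hA; apply: infinite_nat.
suff -> : [set: nat]%classic = (f @^-1` A)%classic.
  by apply: finite_preimage => // i j _ _ /finj.
by apply/seteqP; split=> j _ //; apply: fA.
Qed.

Section NormalForms.

Local Open Scope classical_set_scope.

Variables m n : int.
Hypotheses (hm : m != 0) (hn : n != 0).

(** The relation a b^m a^-1 = b^n reads b^(modulus e) a^e = a^e b^(modulus -e)
for both signs. *)
Definition modulus (e : bool) : int := if e then m else n.

Lemma modulus_neq0 e : modulus e != 0.
Proof. by case: e. Qed.

(** Left multiplication by b^i: the quotient of i + c by the modulus is carried
across a^e, which exchanges the two moduli. *)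
Fixpoint shift (i : int) (s : normal_form) : normal_form :=
  match s with
  | Tail k => Tail (i + k)
  | Syl c e s' => Syl ((i + c) %% modulus e)%Z e
                      (shift (((i + c) %/ modulus e)%Z * modulus (~~ e)) s')
  end.

Fixpoint reduced (s : normal_form) : bool :=
  if s is Syl c e s'
  then [&& (c %% modulus e)%Z == c, ~~ pinch e s' & reduced s']
  else true.

(** The product of two expressions: the powers of b at the junction are merged,
but pinches are left as they are. *)
Fixpoint graft (s u : normal_form) : normal_form :=
  match s with
  | Tail k => shift k u
  | Syl c e s' => Syl c e (graft s' u)
  end.

Lemma shiftD i j s : shift i (shift j s) = shift (i + j) s.
Proof.
elim: s i j => [k|c e s IHs] i j /=; first by rewrite addrA.
have hN := modulus_neq0 e; rewrite IHs -mulrDl -addrA.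
have -> : i + (j + c) = ((j + c) %/ modulus e)%Z * modulus e
                        + (i + ((j + c) %% modulus e)%Z).
  by rewrite [RHS]addrCA -divz_eq.
by rewrite divzMDl // modzMDl (addrC (_ %/ _)%Z).
Qed.

Lemma rep_div0 c e : (c %% modulus e)%Z == c -> (c %/ modulus e)%Z = 0.
Proof.
move=> /eqP hc; have := divz_eq c (modulus e); rewrite hc => /esym/eqP.
by rewrite -subr_eq0 addrK mulf_eq0 (negbTE (modulus_neq0 e)) orbF => /eqP.
Qed.

Lemma shift0 s : reduced s -> shift 0 s = s.
Proof.
elim: s => [k|c e s IHs] /=; first by rewrite add0r.
move=> /and3P[hc _ hs]; rewrite add0r (rep_div0 _ _ hc) mul0r IHs //.
by rewrite (eqP hc).
Qed.

(** The power of b that a carry across a^e lets through is a multiple of the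
modulus of the opposite sign, so it can neither create nor destroy a pinch. *)
Lemma pinch_shift e z s :
  reduced s -> pinch e (shift (z * modulus (~~ e)) s) = pinch e s.
Proof.
case: s => [//|c d s] /= /and3P[hc _ _].
by have [hd|] := eqVneq d (~~ e); rewrite ?andbF // -hd modzMDl (eqP hc).
Qed.

Lemma reduced_shift i s : reduced s -> reduced (shift i s).
Proof.
elim: s i => [//|c e s IHs] i /= /and3P[_ he hs].
by rewrite modz_mod eqxx IHs // pinch_shift // he.
Qed.

(** The defining relation, and its powers, hold for the action. *)
Lemma push_shift e z s : reduced s ->
  push e (shift (z * modulus (~~ e)) s) = shift (z * modulus e) (push e s).
Proof.
move=> hs; rewrite /push pinch_shift //; case: ifP => [|_] /=; last first.
  by rewrite addr0 modzMl mulzK ?modulus_neq0.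
case: s hs => [//|c d s] /= _ /andP[/eqP-> /eqP->].
by rewrite addr0 mulzK ?modulus_neq0 // negbK.
Qed.

Lemma reduced_push e s : reduced s -> reduced (push e s).
Proof.
move=> hs; rewrite /push; case: ifP => [_|hp /=]; last by rewrite hs hp mod0z.
by case: s hs => [//|c d s] /= /and3P[].
Qed.

(** If pushing a^-e cancels a syllable 0, e, then what follows that syllable
does not start with 0, -e since the expression is reduced: pushing a^e then
restores the syllable instead of cancelling again. *)
Lemma pushK e s : reduced s -> push e (push (~~ e) s) = s.
Proof.
move=> hs; rewrite {2}/push; case: ifP => [|_]; last first.
  by rewrite /push /= !eqxx.
case: s hs => [//|c d s] /= /and3P[_ hp _] /andP[/eqP-> /eqP hd].
by move: hp; rewrite hd negbK /push => /negbTE->.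
Qed.

(** * The action of words on normal forms *)

Definition step (l : bool * bool) (s : normal_form) : normal_form :=
  if l.1 then push l.2 s else shift (if l.2 then -1 else 1) s.

Definition act (w : word bool) (s : normal_form) : normal_form :=
  foldr step s w.

Lemma reduced_act w s : reduced s -> reduced (act w s).
Proof.
move=> hs; elim: w => [//|[x d] w IHw] /=; rewrite /step /=.
by case: x; [apply: reduced_push | apply: reduced_shift].
Qed.

Lemma act_cat u v s : act (u ++ v) s = act u (act v s).
Proof. exact: foldr_cat. Qed.

Lemma act_gen_exp k s : reduced s -> act (gen_exp bs_b k) s = shift k s.
Proof.
move=> hs; case: k => p /=.
  elim: p => [|p IHp] /=; first by rewrite shift0.
  by rewrite IHp /step /= shiftD.
rewrite -[LHS]/(act (nseq p.+1 (bs_b, true)) s) NegzE.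
elim: p => [//|p IHp].
rewrite -[LHS]/(step (bs_b, true) (act (nseq p.+1 (bs_b, true)) s)) IHp.
by rewrite /step /= shiftD -opprD.
Qed.

(** Words that are equal in the group act equally on reduced expressions: only
the defining relation and free cancellation have to be checked. *)
Lemma act_word_eq u v s :
  word_eq [set bs_relation m n] u v -> reduced s -> act u s = act v s.
Proof.
move=> huv; elim: huv s => {u v} [u v /= [-> ->]|[x d]|u1 v1 u2 v2 _ IH1 _ IH2
  |//|u v _ IH|u v w _ IH1 _ IH2] s hs.
- rewrite /= -/(act _ _) act_cat !act_gen_exp //=; last exact: reduced_push.
  rewrite /step /= -[m in shift m]mul1r (push_shift false 1) ?reduced_push //.
  by rewrite (pushK false) // mul1r.
- rewrite /= /step /=; case: x => /=; first by rewrite pushK.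
  by rewrite shiftD; case: d; rewrite /= ?addrN ?addNr shift0.
- by rewrite !act_cat IH2 // IH1 ?reduced_act.
- by rewrite IH.
- by rewrite IH1 // IH2.
Qed.

(** * The correspondence between elements and normal forms *)

Local Notation G := (BS m n).

Definition stable (e : bool) : G := pres_class _ [:: (bs_a, e)].
Definition bpow (k : int) : G := pres_class _ (gen_exp bs_b k).

Lemma bpow0 : bpow 0 = 1%g. Proof. by []. Qed.

Lemma stableV e : (stable e * stable (~~ e) = 1)%g.
Proof.
rewrite -[LHS]pres_class_cat; apply/pres_classP; exact: word_eq_cancel.
Qed.

Lemma invg_stable e : ((stable e)^-1 = stable (~~ e))%g.
Proof. by apply: mulg1_eq; rewrite stableV. Qed.

Lemma bpowS k : bpow (1 + k) = (bpow 1 * bpow k)%g.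
Proof.
case: k => [p|[|p]].
- by rewrite -[RHS]pres_class_cat.
- by rewrite -[RHS]pres_class_cat; apply/esym/pres_classP/word_eq_cancel.
rewrite -[RHS]pres_class_cat.
have -> : 1 + Negz p.+1 = Negz p by rewrite !NegzE; lia.
apply/esym/pres_classP.
apply: (word_eq_cat (u1 := [:: _; _]) (v1 := [::])); last exact: word_eq_refl.
exact: word_eq_cancel.
Qed.

Lemma bpowD i j : bpow (i + j) = (bpow i * bpow j)%g.
Proof.
elim/int_rect: i => [|p IHp|p IHp].
- by rewrite add0r bpow0 mul1g.
- by rewrite intS -addrA !bpowS IHp mulgA.
have -> : bpow (- p.+1%:Z + j) = ((bpow 1)^-1 * bpow (- p%:Z + j))%g.
  by apply: (mulgI (bpow 1)); rewrite mulVKg -bpowS; congr bpow; lia.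
rewrite IHp mulgA; congr (_ * _)%g; apply: (mulgI (bpow 1)).
by rewrite mulVKg -bpowS; congr bpow; lia.
Qed.

Lemma bpowN i : bpow (- i) = ((bpow i)^-1)%g.
Proof. by apply/esym/mulg1_eq; rewrite -bpowD addrN. Qed.

(** For q = 1 and either sign, this is the relation of the presentation up to
moving a letter a^+-1 to the other side. *)
Lemma bpow_stable q e :
  (bpow (q * modulus e) * stable e = stable e * bpow (q * modulus (~~ e)))%g.
Proof.
have relA : (stable false * bpow m * stable true = bpow n)%g.
  rewrite -[(stable _ * _)%g]pres_class_cat -[LHS]pres_class_cat.
  by apply/pres_classP; apply: word_eq_rel.
have rel d : (bpow (modulus d) * stable d = stable d * bpow (modulus (~~ d)))%g.
  case: d => /=; rewrite -relA; last by rewrite -mulgA (stableV true) mulg1.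
  by rewrite !mulgA (stableV true) mul1g.
elim/int_rect: q => [|p IHp|p IHp].
- by rewrite !mul0r bpow0 mul1g mulg1.
- by rewrite intS !mulrDl !mul1r !bpowD -mulgA IHp !mulgA rel.
have predM d : modulus d + - p.+1%:Z * modulus d = - p%:Z * modulus d.
  by rewrite -{1}(mul1r (modulus d)) -mulrDl; congr (_ * _); lia.
apply: (mulgI (bpow (modulus e))).
by rewrite !mulgA -bpowD rel -mulgA -bpowD !predM.
Qed.

Fixpoint word_of (s : normal_form) : word bool :=
  match s with
  | Tail k => gen_exp bs_b k
  | Syl c e s' => gen_exp bs_b c ++ [:: (bs_a, e)] ++ word_of s'
  end.

Definition elt (s : normal_form) : G := pres_class _ (word_of s).
Definition nf (g : G) : normal_form := act (repr g) (Tail 0).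

Lemma elt_syl c e s : elt (Syl c e s) = (bpow c * (stable e * elt s))%g.
Proof.
by rewrite -[(stable e * elt s)%g]pres_class_cat -[RHS]pres_class_cat.
Qed.

(** The carry built into [shift] is [bpow_stable], applied at each syllable. *)
Lemma elt_shift i s : elt (shift i s) = (bpow i * elt s)%g.
Proof.
elim: s i => [k|c e s IHs] i; first exact: bpowD.
rewrite /= !elt_syl IHs [(stable e * (_ * _))%g]mulgA -bpow_stable !mulgA.
by rewrite -!bpowD [_ + _ * _]addrC -divz_eq.
Qed.

Lemma elt_push e s : elt (push e s) = (stable e * elt s)%g.
Proof.
rewrite /push; case: ifP => [|_]; last by rewrite elt_syl bpow0 mul1g.
case: s => [//|c d s] /= /andP[/eqP-> /eqP->].
by rewrite elt_syl bpow0 mul1g mulgA stableV mul1g.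
Qed.

Lemma elt_graft s u : elt (graft s u) = (elt s * elt u)%g.
Proof.
elim: s => [k|c e s IHs] /=; first exact: elt_shift.
by rewrite !elt_syl IHs !mulgA.
Qed.

Lemma elt_iter j e s :
  elt (iter j (Syl 0 e) s) = (stable e ^+ j * elt s)%g.
Proof.
elim: j => [|j IHj]; first by rewrite expg0 mul1g.
by rewrite iterS elt_syl bpow0 mul1g IHj mulgA -expgS.
Qed.

Lemma nf_pres_class w : nf (pres_class _ w) = act w (Tail 0).
Proof. by apply: act_word_eq => //; apply: word_eq_repr. Qed.

(** Uniqueness of the normal form: acting on the empty expression, the letters
of a reduced expression rebuild it syllable by syllable, since no push meets a
pinch. *)
Lemma eltK s : reduced s -> nf (elt s) = s.
Proof.
rewrite nf_pres_class.
elim: s => [k _|c e s IHs /and3P[hc hp hs]].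
  by rewrite act_gen_exp //= addr0.
rewrite [word_of _]/= act_cat.
rewrite -[act (_ :: _) _]/(push e (act (word_of s) (Tail 0))) IHs //.
rewrite /push (negbTE hp).
rewrite act_gen_exp; last by rewrite /= mod0z eqxx hp.
by rewrite /= addr0 (eqP hc) rep_div0 // mul0r shift0.
Qed.

Lemma nfK g : elt (nf g) = g.
Proof.
rewrite -{2}(pres_class_repr g) /nf.
elim: (repr g) => [//|[x d] w IHw]; rewrite [RHS](pres_class_cat _ [:: _]).
rewrite /= -/(act _ _) -IHw /step /=.
case: x => /=; first exact: elt_push.
by rewrite elt_shift; case: d.
Qed.

Lemma reduced_nf g : reduced (nf g).
Proof. exact: reduced_act. Qed.

Lemma bpow_inj : injective bpow.
Proof.
move=> i j hij.
by have := congr1 nf (hij : elt (Tail i) = elt (Tail j)); rewrite !eltK // => -[].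
Qed.

(** * Conjugates of elements with a syllable *)

(** Only the junction can contain a pinch: there the last exponent of [s] is
added to the first exponent of [u]. *)
Lemma reduced_graft c e s u :
  reduced (Syl c e s) -> reduced u ->
  ~~ pinch (last_sign e s) (shift (tail_exp s) u) ->
  reduced (Syl c e (graft s u)).
Proof.
elim: s c e => [k|d f s IHs] c e.
  by move=> /= /andP[-> _] hu ->; rewrite reduced_shift.
by move=> /and3P[hc hp hs] hu hl; apply/and3P; split=> //; apply: IHs.
Qed.

Lemma reduced_iter j e u :
  reduced u -> ~~ pinch e u -> reduced (iter j (Syl 0 e) u).
Proof.
move=> hu hp; elim: j => [//|j IHj]; rewrite iterS /= IHj mod0z eqxx andbT /=.
by case: j {IHj} => [//|j] /=; case: (e).
Qed.

Lemma pinch_shift_syl t e c d s :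
  pinch e (shift t (Syl c d s)) =
  (d == ~~ e) && (modulus (~~ e) %| t + c)%Z.
Proof.
rewrite /= andbC; case: eqVneq => [->|//] /=.
by apply/eqP/dvdz_mod0P.
Qed.

Lemma syllables_shift i s : syllables (shift i s) = syllables s.
Proof. by elim: s i => //= c e s IHs i; rewrite IHs. Qed.

Lemma syllables_graft s u :
  syllables (graft s u) = (syllables s + syllables u)%N.
Proof. by elim: s => [k|c e s IHs] /=; rewrite ?syllables_shift ?IHs. Qed.

Lemma syllables_iter j c e s :
  syllables (iter j (Syl c e) s) = (j + syllables s)%N.
Proof. by elim: j => [//|j IHj]; rewrite iterS /= IHj. Qed.

(** Modulo 1 the only residue is 0, so in a reduced expression a letter a^-e
comes with the exponent 0; directly after a^e it would make a pinch.  Thus the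
sign e, once it has occurred, is kept to the end. *)
Lemma last_sign_modulus1 c e s :
  (`|modulus (~~ e)| = 1)%N -> reduced (Syl c e s) -> last_sign e s = e.
Proof.
move=> hN; elim: s c => [//|d f s IHs] c /and3P[_ hp hs].
have [hf|hf] := eqVneq f (~~ e); last first.
  have {}hf : f = e by case: (f) (e) hf => [] [].
  by rewrite /= hf; rewrite hf in hs; apply: IHs hs.
case/negP: hp; rewrite /= hf eqxx andbT; move: hs => /= /and3P[/eqP<- _ _].
by apply/eqP/dvdz_mod0P; rewrite hf dvdzE hN dvd1n.
Qed.

(** The conjugate of an element by a^(e j) b^t, spelled out syllable by syllable.
Once the expression on the left is known to be reduced, its syllables are those
of the conjugate. *)
Lemma conj_elt s t j e :
  elt (iter j (Syl 0 e) (shift t (graft s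
         (shift (- t) (iter j (Syl 0 (~~ e)) (Tail 0))))))
  = ((stable e ^+ j * bpow t) * elt s * (stable e ^+ j * bpow t)^-1)%g.
Proof.
rewrite elt_iter elt_shift elt_graft elt_shift elt_iter bpowN.
by rewrite invgM -expVgn invg_stable [elt (Tail 0)]bpow0 mulg1 !mulgA.
Qed.

(** The conditions say that a^e b^t meets no pinch on the left of the expression
and that b^-t a^-e meets none on the right.  With P the larger modulus, c the
first exponent and k the last one, they ask that P does not divide t + c (if
the expression starts with -e) and that P does not divide k - t (if it ends
with e).  One condition alone is met by making the exponent equal to 1.  Both
can occur only when P > 2, by [last_sign_modulus1], and then one of the values
1 and 2 of t + c will do. *)
Lemma exists_shift e c d s :
  (`|modulus e| < `|modulus (~~ e)|)%N -> reduced (Syl c d s) ->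
  exists t, ~~ pinch e (shift t (Syl c d s)) /\
            ~~ ((last_sign d s == e) && (modulus (~~ e) %| tail_exp s - t)%Z).
Proof.
move=> hlt hs; have hN := modulus_neq0 e.
have hdvd z : (0 < `|z| < `|modulus (~~ e)|)%N -> (modulus (~~ e) %| z)%Z = false.
  by move=> /andP[z0 zlt]; rewrite dvdzE gtnNdvd.
(* The first sign is e: any t is good on the left; make k - t = 1. *)
have [hd|hd] := eqVneq d (~~ e); last first.
  exists (tail_exp s - 1); rewrite pinch_shift_syl (negbTE hd); split=> //.
  by rewrite opprB addrCA addrN addr0 hdvd ?andbF //; lia.
(* The last sign is -e: any t is good on the right; make t + c = 1. *)
have [hl|hl] := eqVneq (last_sign d s) e; last first.
  exists (1 - c); rewrite pinch_shift_syl subrK; split=> //.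
  by rewrite hdvd ?andbF //; lia.
have h2 : (2 < `|modulus (~~ e)|)%N.
  rewrite ltnNge; apply/negP => hle.
  have h1 : (`|modulus (~~ d)| = 1)%N by rewrite hd negbK; lia.
  by have := last_sign_modulus1 _ _ _ h1 hs; rewrite hl hd; case: (e).
(* If t = 1 - c fails on the right, P divides k - t, so not k - (t + 1). *)
have [h|h] := boolP (modulus (~~ e) %| tail_exp s - (1 - c))%Z; last first.
  exists (1 - c); rewrite pinch_shift_syl subrK (negbTE h) andbF; split=> //.
  by rewrite hdvd ?andbF //; lia.
exists (2 - c); rewrite pinch_shift_syl subrK hdvd ?andbF; last by lia.
split=> //=; have -> : tail_exp s - (2 - c) = tail_exp s - (1 - c) - 1 by lia.
by rewrite dvdzE -dvdzE rpredBl // hdvd //; lia.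
Qed.

Lemma infinite_conj_syl c d s :
  `|m| != `|n| -> reduced (Syl c d s) ->
  infinite_set (conj_class (elt (Syl c d s))).
Proof.
move=> hmn hs.
have [e hlt] : exists e, (`|modulus e| < `|modulus (~~ e)|)%N.
  by have [h|h] := ltnP `|m| `|n|; [exists true | exists false] => //=; lia.
have [t [h1 h2]] := exists_shift _ _ _ _ hlt hs.
pose S j := iter j (Syl 0 e) (shift t (graft (Syl c d s)
              (shift (- t) (iter j (Syl 0 (~~ e)) (Tail 0))))).
have redS j : reduced (S j).
  apply: reduced_iter; last exact: h1.
  apply: reduced_shift; apply: reduced_graft => //.
    by apply: reduced_shift; apply: reduced_iter.
  rewrite shiftD; case: j => [//|j].
  rewrite iterS pinch_shift_syl addr0; apply: contra h2 => /andP[/eqP hl].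
  by rewrite -hl => ->; rewrite -[e]negbK hl negbK eqxx.
apply: (@infinite_of_injective _ _ (fun j => elt (S j))) => [i j hij|j].
  have := congr1 (syllables \o nf) hij; rewrite /= !eltK //.
  rewrite /S !syllables_iter !syllables_shift !syllables_graft.
  by rewrite !syllables_shift !syllables_iter; lia.
by rewrite conj_elt; exists (stable e ^+ j * bpow t)%g.
Qed.

(** * Conjugates of powers of b *)

Lemma commute_bpow_mul g k z :
  commute g (bpow k) -> commute g (bpow (k * z)).
Proof.
move=> hg; elim/int_rect: z => [|p IHp|p IHp].
- by rewrite mulr0; apply: commute1.
- by rewrite intS mulrDr mulr1 bpowD; apply: commuteM.
have -> : k * - p.+1%:Z = - k + k * - p%:Z by rewrite intS opprD mulrDr mulrN1.
by rewrite bpowD bpowN; apply: commuteM => //; apply: commuteV.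
Qed.

Lemma bpow_stableX z d :
  (bpow (z * n ^+ d) * stable false ^+ d
   = stable false ^+ d * bpow (z * m ^+ d))%g.
Proof.
elim: d z => [|d IHd] z; first by rewrite !expr0 expg0 mul1g mulg1.
rewrite expgS mulgA exprSr mulrA (bpow_stable _ false) -!mulgA; congr (_ * _)%g.
by rewrite /= -mulrA [_ * m]mulrC mulrA IHd exprS mulrA.
Qed.

(** If a^d commutes with b^k, it commutes with b^(k m^d), whose conjugate by a^d
is b^(k n^d).  As b has infinite order, m^d = n^d, which is impossible for
d > 0 and |m| <> |n|. *)
Lemma stableX_bpow_ncommute d k : `|m| != `|n| -> k != 0 ->
  ~ commute (stable false ^+ d.+1)%g (bpow k).
Proof.
move=> hmn hk hc.
have := bpow_stableX k d.+1; rewrite (commute_bpow_mul _ _ _ hc).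
move=> /mulIg/bpow_inj/(mulfI hk) /(congr1 Num.norm); rewrite !normrX => /eqP.
by rewrite eqrXn2 ?normr_ge0 // eq_sym (negbTE hmn).
Qed.

Lemma infinite_conj_bpow k :
  `|m| != `|n| -> k != 0 -> infinite_set (conj_class (bpow k)).
Proof.
move=> hmn hk; pose g j : G := (stable false ^+ j)%g.
apply: (@infinite_of_injective _ _ (fun j => g j * bpow k * (g j)^-1)%g);
  last by move=> j; exists (g j).
suff lt_neq i j : (i < j)%N -> (g i * bpow k * (g i)^-1)%g
                            <> (g j * bpow k * (g j)^-1)%g.
  move=> i j hij; case: (ltngtP i j) => // [/lt_neq|/lt_neq] []; first exact: hij.
  exact: esym hij.
move=> lt_ij hij; apply: (stableX_bpow_ncommute (j - i).-1 _ hmn hk).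
rewrite prednK ?subn_gt0 // -/(g _).
have gj : g j = (g i * g (j - i)%N)%g by rewrite /g -expgnDr subnKC // ltnW.
move: hij; rewrite gj invgM -!mulgA => /mulgI; rewrite !mulgA => /mulIg.
by move=> /(congr1 (fun x => x * g (j - i)%N)%g); rewrite mulgVK => /esym.
Qed.

(** * The case of equal absolute values *)

(** Here z is m or -m, that is, plus or minus either modulus; [bpow_stable] with
a coefficient 1 or -1 moves such a power across a^+-1. *)
Lemma conj_bpow_norm g z : `|m| = `|n| -> `|z| = `|m| ->
  exists2 z', `|z'| = `|m| & (g * bpow z = bpow z' * g)%g.
Proof.
move=> hmn; rewrite -(pres_class_repr g).
elim: (repr g) z => [|[x e] w IHw] z hz.
  by exists z => //; rewrite mulg1 mul1g.
have [z1 hz1 hw] := IHw _ hz.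
pose l : G := pres_class _ [:: (x, e)].
have [z2 hz2 hl] : exists2 z2, `|z2| = `|m| & (l * bpow z1 = bpow z2 * l)%g.
  rewrite /l; case: x {l}; last first.
    exists z1 => //; case: e.
      by rewrite -[pres_class _ _]/(bpow (-1)) -!bpowD addrC.
    by rewrite -[pres_class _ _]/(bpow 1) -!bpowD addrC.
  have hN d : `|modulus d| = `|m| by case: d.
  have [q hq1 hq2] : exists2 q, `|q| = 1 & z1 = q * modulus (~~ e).
    move/eqP: hz1; rewrite -(hN (~~ e)) eqr_norm2 => /orP[]/eqP->.
      by exists 1; rewrite ?normr1 ?mul1r.
    by exists (-1); rewrite ?normrN ?normr1 ?mulN1r.
  exists (q * modulus e); first by rewrite normrM hq1 mul1r.
  by rewrite hq2 -bpow_stable.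
exists z2 => //.
have -> : pres_class _ ((x, e) :: w) = (l * pres_class _ w)%g.
  by rewrite -[RHS]pres_class_cat.
by rewrite -mulgA hw !mulgA hl.
Qed.

(** * The infinite conjugacy class property *)

Lemma ICC_of_norm_neq : `|m| != `|n| -> ICC G.
Proof.
move=> hmn; split.
  apply: (@infinite_of_injective _ _ (bpow \o Posz)) => [|//].
  by move=> i j /bpow_inj [].
move=> x; rewrite -(nfK x); have := reduced_nf x.
case: (nf x) => [k _ hk|c d s hs _]; last exact: infinite_conj_syl.
apply: infinite_conj_bpow => //; apply/eqP => k0; apply: hk.
by rewrite k0.
Qed.

Lemma norm_neq_of_ICC : ICC G -> `|m| != `|n|.
Proof.
move=> [_ hG]; apply/eqP => hmn.
have m1 : bpow m <> 1%g by rewrite -bpow0 => /bpow_inj/eqP; apply/negP.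
apply: (hG _ m1); apply: (@sub_finite_set _ _ [set bpow m; bpow (- m)]) => //.
move=> _ [g _ <-]; have [z hz ->] := conj_bpow_norm g m hmn erefl.
rewrite mulgK; move/eqP: hz; rewrite eqr_norm2 => /orP[]/eqP->; [by left|by right].
Qed.

End NormalForms.

Theorem mainTheorem4 (m n : int) (hm : m != 0) (hn : n != 0) :
  ICC (BS m n) <-> `|m| != `|n|.
Proof.
by split; [apply: norm_neq_of_ICC | apply: ICC_of_norm_neq].
Qed.
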